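(* Let $p$ be a prime number, $\nu$ a positive integer and $z\in\mathbb{Z}$. Then the $p$-adic valuation of the integer $B_{p^\nu-1}(z)$ satisfies $$v_p\bigl(B_{p^\nu-1}(z)\bigr)\;\geq\;\#\{\xi\in\mathrm{Hom}(\Lambda,\mathbb{F}_{p^\nu}^* ) \mid W(\xi)=z\ \text{in}\ \mathbb{F}_{p^\nu}\},$$ where $\mathrm{Hom}(\Lambda,\mathbb{F}_{p^\nu}^* )\simeq(\mathbb{F}_{p^\nu}^* )^n$ via any choice of $\mathbb{Z}$-basis of $\Lambda$.
   Context: Setting: $n\ge 1$, $\mathfrak{A}\subset\mathbb{Z}^n$ is a finite set, and $c_{\mathsf a}$ ($\mathsf a\in\mathfrak{A}$) are positive integers. $\Lambda\subset\mathbb{Z}^n$ is the lattice spanned over $\mathbb{Z}$ by all differences $\mathsf a-\mathsf b$ with $\mathsf a,\mathsf b\in\mathfrak{A}$; it is assumed throughout that $\Lambda$ has rank $n$. For a commutative ring $R$ and a homomorphism $\mathsf x:\Lambda\to R^*$ put $W(\mathsf x)=\sum_{\mathsf a,\mathsf b\in\mathfrak{A}}c_{\mathsf a}c_{\mathsf b}\,\mathsf x(\mathsf a-\mathsf b)\in R$. For a positive integer $N$ let $\mu_N\subset\mathbb{C}^*$ be the group of $N$-th roots of unity and $B_N(z)=\prod_{\mathsf x\in\mathrm{Hom}(\Lambda,\mu_N)}(z-W(\mathsf x))$; this is a polynomial with coefficients in $\mathbb{Z}$. $\mathbb{F}_{p^\nu}$ is the field with $p^\nu$ elements. For a nonzero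 integer $k$, $v_p(k)=\max\{v\in\mathbb{Z} \mid p^v \text{ divides } k\}$, and $v_p(0)=+\infty$. *)

(* Defs.v *)
From HB Require Import structures.
From mathcomp Require Import all_boot all_order all_algebra finmap.
From mathcomp Require Import boolp classical_sets functions cardinality.
From mathcomp Require Import constructive_ereal reals.
From mathcomp Require Import complex.

Set Implicit Arguments.
Unset Strict Implicit.
Unset Printing Implicit Defensive.

Import Order.TTheory GRing.Theory Num.Theory.

Local Open Scope classical_set_scope.
Local Open Scope ring_scope.

Section Lattice.
Variables (n : nat) (A : {fset 'rV[int]_n}).

Definition diff_span : {pred 'rV[int]_n} := fun v =>
  `[< exists k : A -> A -> int,
        v = \sum_(a : A) \sum_(b : A) (val a - val b) *~ k a b >].

Fact diff_span_zmod_closed : zmod_closed diff_span.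
Proof.
split=> [|u v /asboolP[k ->] /asboolP[l ->]]; apply/asboolP.
  by exists (fun _ _ => 0); rewrite big1// => a _; rewrite big1// => b _.
exists (fun a b => k a b - l a b).
rewrite -sumrB; apply: eq_bigr => a _; rewrite -sumrB; apply: eq_bigr => b _.
by rewrite mulrzBr.
Qed.

HB.instance Definition _ :=
  GRing.isZmodClosed.Build 'rV[int]_n diff_span diff_span_zmod_closed.

Record lattice := Lattice { lattice_val :> 'rV[int]_n;
                            _ : lattice_val \in diff_span }.

HB.instance Definition _ := [isSub for lattice_val].
HB.instance Definition _ := [Choice of lattice by <:].
HB.instance Definition _ := [SubChoice_isSubZmodule of lattice by <:].

Fact diff_subproof (a b : A) : val a - val b \in diff_span.
Proof.
apply/asboolP; exists (fun a' b' => ((a' == a) && (b' == b))%:R).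
rewrite (bigD1 a)//= (bigD1 b)//= !eqxx/= mulr1z.
rewrite big1 => [|b' /negPf->//]; rewrite addr0.
by rewrite big1 ?addr0// => a' /negPf->; rewrite big1// => b' _.
Qed.

Definition diff (a b : A) : lattice := Lattice (diff_subproof a b).

Definition zbasis (r : nat) (e : 'I_r -> lattice) :=
  forall v : lattice, exists! k : {ffun 'I_r -> int}, v = \sum_i e i *~ k i.

Definition lattice_rank (r : nat) := exists e : 'I_r -> lattice, zbasis e.

(* Hom(Lambda, R^* ), as a set of functions to R with values in the units;
   Lambda is written additively. *)
Definition Hom_units (R : comUnitRingType) : set (lattice -> R) :=
  [set x | (forall v, x v \is a GRing.unit) /\
           (forall u v, x (u + v) = x u * x v)].
Arguments Hom_units : clear implicits.

Definition Hom_mu (N : nat) (C : comUnitRingType) : set (lattice -> C) :=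
  [set x | Hom_units C x /\ (forall v, N.-unity_root (x v))].
Arguments Hom_mu : clear implicits.

Definition W (c : A -> nat) (R : comUnitRingType) (x : lattice -> R) : R :=
  \sum_(a : A) \sum_(b : A) (c a * c b)%:R * x (diff a b).

(* fset_set sends an infinite set to fset0. The set is finite when N > 0 and C
   is a numClosedFieldType (finite_Hom_mu); N = 0 is meaningless, since every
   element is a 0.-unity_root. *)
Definition B_poly (c : A -> nat) (N : nat) (C : comUnitRingType) : {poly C} :=
  \prod_(x <- fset_set (Hom_mu N C)) ('X - (W c x)%:P).

Lemma Hom_units_eq (R : comUnitRingType) (x y : lattice -> R) :
  Hom_units R x -> Hom_units R y ->
  (forall a b, x (diff a b) = y (diff a b)) -> x = y.
Proof.
have H0 (z : lattice -> R) : Hom_units R z -> z 0 = 1.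
  move=> [zU zM]; apply: (mulrI (zU 0)).
  by rewrite mulr1 -zM addr0.
have HN (z : lattice -> R) u : Hom_units R z -> z (- u) = (z u)^-1.
  move=> Hz; have [zU zM] := Hz; apply: (mulrI (zU u)).
  by rewrite -zM subrr H0// divrr.
move=> Hx Hy exy; apply/funext => v.
pose K := [pred v | x v == y v].
have K0 : 0 \in K by rewrite inE !H0.
have KD u w : u \in K -> w \in K -> u + w \in K.
  rewrite !inE => /eqP xu /eqP xw.
  by rewrite (proj2 Hx) (proj2 Hy) xu xw.
have KN u : u \in K -> - u \in K by rewrite !inE => /eqP xu; rewrite !HN// xu.
have KMz u k : u \in K -> u *~ k \in K.
  move=> Ku; have Kn m : u *+ m \in K.
    by elim: m => [|m IHm]; rewrite ?mulr0n// mulrS KD.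
  by case: k => m; rewrite ?NegzE ?mulrNz -pmulrn ?KN.
suff : v \in K by move/eqP.
have /asboolP[k vE] := valP v.
have -> : v = \sum_(a : A) \sum_(b : A) diff a b *~ k a b.
  apply: val_inj; rewrite vE raddf_sum; apply: eq_bigr => a _.
  by rewrite raddf_sum; apply: eq_bigr => b _; rewrite raddfMz.
apply: (big_ind (fun u => u \in K)) => // a _.
apply: (big_ind (fun u => u \in K)) => // b _.
by apply: KMz; rewrite inE exy.
Qed.

Lemma finite_Hom_values (R : comUnitRingType) (s : seq R) :
  finite_set [set x : lattice -> R | Hom_units R x /\ forall v, x v \in s].
Proof.
pose D := [set x : lattice -> R | Hom_units R x /\ forall v, x v \in s].
pose f (x : lattice -> R) : {ffun A * A -> 'I_(size s).+1} :=
  [ffun ab => inord (index (x (diff ab.1 ab.2)) s)].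
pose g F := xget (fun=> 1) [set x | D x /\ f x = F].
apply: (sub_finite_set _ (finite_image g (@finite_finset _ setT))).
move=> x Dx; exists (f x) => //.
have [Dgx fgx] : D (g (f x)) /\ f (g (f x)) = f x.
  by apply: (xgetPex (fun=> 1) (P := [set y | D y /\ f y = f x])); exists x.
apply: Hom_units_eq (proj1 Dgx) (proj1 Dx) _ => a b.
move/ffunP/(_ (a, b)): fgx; rewrite !ffunE => /(congr1 val) /=.
rewrite !inordK ?ltnS ?index_size// => eq_i.
rewrite -(nth_index 0 (proj2 Dgx (diff a b))) eq_i.
by rewrite nth_index ?(proj2 Dx).
Qed.

Lemma finite_Hom_units (F : finFieldType) : finite_set (Hom_units F).
Proof.
apply: sub_finite_set (@finite_Hom_values F (enum F)) => x Hx /=.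
by split=> // v; rewrite mem_enum.
Qed.

End Lattice.

Arguments lattice_rank {n} A r.
Arguments Hom_units {n} A R _.
Arguments Hom_mu {n} A N C _.
Arguments W {n A} c R x.
Arguments B_poly {n A} c N C.

Lemma finite_Hom_mu n (A : {fset 'rV[int]_n}) (N : nat)
  (C : numClosedFieldType) : (0 < N)%N -> finite_set (Hom_mu A N C).
Proof.
move=> N_gt0; have [rs rsE] := closed_field_poly_normal ('X^N - 1 : {poly C}).
apply: sub_finite_set (@finite_Hom_values n A C rs) => x [Hx xN] /=.
split=> // v; have := xN v; rewrite -topredE /= /root_of_unity rsE.
rewrite rootZ ?root_prod_XsubC// lead_coef_eq0.
by rewrite -size_poly_eq0 size_XnsubC.
Qed.

Definition vp (p : nat) (k : int) : \bar int :=
  if k == 0 then +oo%E else ((logn p `|k|%N)%:Z)%:E.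

(* Main.v *)
Require Import Defs.
From mathcomp Require Import all_boot all_order all_algebra finmap.
From mathcomp Require Import cyclic separable finfield cyclotomic.
From mathcomp Require Import boolp classical_sets functions cardinality.
From mathcomp Require Import constructive_ereal reals.
From mathcomp Require Import complex.

Set Implicit Arguments.
Unset Strict Implicit.
Unset Printing Implicit Defensive.

Import Order.TTheory GRing.Theory Num.Theory.

(** Fix a Z-basis of the lattice, put N = p^nu - 1 and G = (Z/N)^n, and let f : G
    -> Z be the push-forward of the weights c_a c_b along (a, b) |-> a - b mod N.
    Over any field containing a primitive N-th root of unity the integer matrix
    M = (f(h - g))_{g,h} is diagonalized by the matrix of characters of G, with
    the values W(x), x in Hom(Lambda, mu_N), as eigenvalues. Over C this gives
    B_N = char_poly M, whence B_N(z) = det (z - M). Over F_{p^nu} it shows that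
    z - M has corank m, the number of xi with W(xi) = z; by the Smith normal form
    an integer matrix of corank m modulo p has determinant divisible by p^m. *)

Local Open Scope classical_set_scope.
Local Open Scope ring_scope.

(** * Matrix preliminaries: rank modulo p, determinant and similarity *)

Lemma mxrank_diag (F : fieldType) (n : nat) (d : 'rV[F]_n) :
  \rank (diag_mx d) = (\sum_i (d 0%R i != 0%R))%N.
Proof.
elim: n d => [|n IHn] d; first by rewrite thinmx0 mxrank0 big_ord0.
have block (l : 'rV[F]_1) (r : 'rV[F]_n) :
    \rank (diag_mx (row_mx l r)) = ((l 0%R 0%R != 0%R) + \rank (diag_mx r))%N.
  rewrite diag_mx_row rank_diag_block_mx; congr (_ + _)%N.
  rewrite rank_rV; congr (~~ _ : nat); apply/eqP/eqP => [/matrixP/(_ 0 0)|l0].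
    by rewrite !mxE eqxx.
  by apply/matrixP => i j; rewrite !mxE !ord1 l0 mul0rn.
have := block (lsubmx (d : 'rV_(1 + n))) (rsubmx (d : 'rV_(1 + n))).
rewrite hsubmxK => rk; apply: etrans rk _; rewrite IHn big_ord_recl mxE.
congr (_ + _)%N; first by congr ((d _ _ != 0) : nat); apply: val_inj.
apply: eq_bigr => i _; rewrite mxE.
by congr ((d _ _ != 0) : nat); apply: val_inj.
Qed.

(** The unimodular factors of the Smith form stay invertible over [F], so the corank counts the
    diagonal entries divisible by p, and each of these contributes a factor p to the determinant. *)
Lemma prime_exp_dvd_det (F : fieldType) (p n : nat) (M : 'M[int]_n) :
  p \in [pchar F] ->
  (p ^ (n - \rank (map_mx intr M : 'M[F]_n)) %| `|\det M|)%N.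
Proof.
move=> charFp.
have [L Lu [U Uu [d _ ->]]] := int_Smith_normal_form M.
set S := \matrix_(i, j) _.
have SE : S = diag_mx (\row_i d`_i) by apply/matrixP => i j; rewrite !mxE.
have mapu (P : 'M[int]_n) : P \in unitmx -> map_mx intr P \in @unitmx F n.
  by rewrite !unitmxE det_map_mx; apply: rmorph_unit.
rewrite !map_mxM mxrankMfree ?row_free_unit ?mapu //.
have Lf : row_full (map_mx intr L : 'M[F]_n) by rewrite row_full_unit mapu.
rewrite (eqmxMfull _ Lf).
have -> : map_mx intr S = diag_mx (\row_i (d`_i)%:~R) :> 'M[F]_n.
  by apply/matrixP => i j; rewrite !mxE rmorphMn.
rewrite mxrank_diag !det_mulmx !abszM.
apply/dvdn_mulr/dvdn_mull; rewrite SE det_diag.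
have -> : (n - \sum_(i < n) ((\row_i (d`_i)%:~R)%R 0%R i != 0%R :> F) =
           \sum_(i < n) (p %| `|(d`_i)%R|))%N.
  rewrite -[X in (X - _)%N](card_ord n) -sum1_card -sumnB; last first.
    by move=> i; case: eqP.
  apply: eq_bigr => i _; rewrite !mxE.
  have -> : ((d`_i)%:~R == 0 :> F) = (p %| `|(d`_i)%R|)%N.
    by rewrite -(dvdz_pcharf charFp).
  by case: (p %| _)%N.
elim/big_rec2: _ => [|i k P _ kP]; first by rewrite expn0 dvd1n.
rewrite abszM mxE expnD dvdn_mul //.
by case: (boolP (p %| _)%N); rewrite ?expn1 ?expn0 ?dvd1n.
Qed.

(** In (X - M) V = V (X - D), the nonzero constant det V cancels after taking determinants. *)
Lemma char_poly_similar (F : fieldType) (n : nat) (M V D : 'M[F]_n) :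
  V \in unitmx -> M *m V = V *m D -> char_poly M = char_poly D.
Proof.
move=> Vu MV; have Vp : \det (map_mx polyC V) != 0 :> {poly F}.
  by rewrite det_map_mx polyC_eq0 -unitfE -unitmxE.
apply: (mulIf Vp); rewrite [RHS]mulrC /char_poly -!det_mulmx; congr (\det _).
rewrite mulmxBl mulmxBr -!map_mxM MV; congr (_ - _).
by rewrite scalar_mxC.
Qed.

(** * Characters and circulant matrices of a finite abelian group *)

Section FiniteFourier.
Variables (n N : nat).
(** The modulus is [N.+1], since ['I_N.+1] carries the additive group structure; it plays the role
    of N in the overview. *)
Local Notation G := {ffun 'I_n -> 'I_N.+1}.

Local Notation elt := (@enum_val G G).

Lemma big_elt (T : Type) (idx : T) (op : Monoid.com_law idx) (H : G -> T) :
  \big[op/idx]_g H g = \big[op/idx]_i H (elt i).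
Proof. exact: reindex (onW_bij _ (@enum_val_bij G)). Qed.

Definition circulant (f : G -> int) : 'M[int]_#|G| :=
  \matrix_(i, j) f (elt j - elt i).

Section Characters.
Variables (K : fieldType) (w : K).
Hypothesis w_prim : N.+1.-primitive_root w.

Definition chr (x g : G) : K := \prod_i w ^+ (x i * g i).

Lemma chrD (x : G) : {morph chr x : g h / g + h >-> g * h}.
Proof.
move=> g h; rewrite -big_split; apply: eq_bigr => i _ /=.
rewrite ffunE -exprD -mulnDr !exprM /= expr_mod //.
by rewrite -exprM mulnC exprM (prim_expr_order w_prim) expr1n.
Qed.

Let w_neq0 : w != 0.
Proof.
apply/eqP => w0; have := prim_expr_order w_prim.
by rewrite w0 expr0n => /esym/eqP; rewrite oner_eq0.
Qed.

Lemma chr_neq0 (x g : G) : chr x g != 0.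
Proof.
by apply/prodf_neq0 => i _; apply: expf_neq0.
Qed.

(** The sum over G factors into one geometric sum per coordinate; where x and y differ, the ratio is
    an (N+1)-th root of unity other than 1 and the sum vanishes. *)
Lemma chr_orthogonal (x y : G) :
  \sum_g chr x g / chr y g = (x == y)%:R * (N.+1 ^ n)%:R.
Proof.
pose r i := w ^+ x i / w ^+ y i.
transitivity (\prod_(i < n) \sum_(j < N.+1) r i ^+ j).
  rewrite bigA_distr_bigA /=; apply: eq_bigr => g _.
  rewrite -prodf_div; apply: eq_bigr => i _.
  by rewrite expr_div_n -!exprM.
have [eq_xy | neq_xy] := eqVneq x y.
  rewrite /r eq_xy mul1r -[n in RHS]card_ord natrX -prodr_const.
  apply: eq_bigr => i _; rewrite divff ?expf_neq0 // (eq_bigr (fun=> 1)) => [|j _]; last first.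
    by rewrite expr1n.
  by rewrite sumr_const card_ord.
have [i neq_i] : exists i, x i != y i.
  apply/existsP; apply: contra_neqT neq_xy => /existsPn xy.
  by apply/ffunP => i; have /negPn/eqP := xy i.
rewrite mul0r (bigD1 i) //=; apply/eqP; rewrite mulf_eq0; apply/orP; left.
have r1 : r i - 1 != 0.
  rewrite subr_eq0; apply: contra neq_i => /eqP ri.
  have : w ^+ x i = w ^+ y i by rewrite -[RHS]mul1r -ri divfK // expf_neq0.
  by move/eqP; rewrite (eq_prim_root_expr w_prim) !modn_small.
rewrite -(inj_eq (mulfI r1)) mulr0 -subrX1 subr_eq0 expr_div_n -!exprM.
by rewrite ![(_ * N.+1)%N]mulnC !exprM (prim_expr_order w_prim) !expr1n divr1.
Qed.

Definition chr_mx : 'M[K]_#|G| := \matrix_(i, j) chr (elt j) (elt i).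

(** By orthogonality the matrix of inverse characters is an inverse up to the factor (N+1)^n, which
    is nonzero in [K] because [K] contains a primitive (N+1)-th root of unity. *)
Lemma chr_mx_unit : chr_mx \in unitmx.
Proof.
pose U : 'M[K]_#|G| := \matrix_(i, j) (chr (elt i) (elt j))^-1.
have UV : U *m chr_mx = (N.+1 ^ n)%:R%:M.
  apply/matrixP => i j; rewrite !mxE.
  under eq_bigr do rewrite !mxE mulrC.
  rewrite -(big_elt _ (fun g => chr (elt j) g / chr (elt i) g)).
  rewrite chr_orthogonal (inj_eq enum_val_inj) eq_sym.
  by case: eqP; rewrite ?mul1r ?mul0r.
have : U *m chr_mx \in unitmx.
  rewrite UV unitmxE det_scalar unitfE natrX.
  by rewrite !expf_neq0 // (prim_root_natf_neq0 w_prim).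
by rewrite unitmx_mul => /andP[].
Qed.

Definition fourier (f : G -> int) (x : G) : K := \sum_g (f g)%:~R * chr x g.

Lemma circulant_chr_mx (f : G -> int) :
  map_mx intr (circulant f) *m chr_mx =
  chr_mx *m diag_mx (\row_j fourier f (elt j)).
Proof.
apply/matrixP => i j; rewrite mul_mx_diag !mxE mulr_sumr.
under eq_bigr do rewrite !mxE.
rewrite -(big_elt _ (fun h => (f (h - elt i))%:~R * chr (elt j) h)).
(* The translation h = [elt i] + g extracts the value of the character at [elt i]: each character is
   an eigenvector. *)
rewrite (reindex_inj (addrI (elt i))) /=; apply: eq_bigr => g _.
by rewrite addrAC subrr add0r chrD mulrCA.
Qed.

Lemma char_poly_circulant (f : G -> int) :
  map_poly intr (char_poly (circulant f)) =
  \prod_x ('X - (fourier f x)%:P) :> {poly K}.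
Proof.
rewrite map_char_poly (char_poly_similar chr_mx_unit (circulant_chr_mx f)).
rewrite char_poly_trig ?diag_mx_is_trig // [RHS]big_elt.
by apply: eq_bigr => i _; rewrite !mxE eqxx.
Qed.

(** The characters also diagonalize z - M, with eigenvalues z - [fourier f x]; the rank counts the
    nonzero ones. *)
Lemma mxrank_circulant (f : G -> int) (z : int) :
  \rank (map_mx intr (z%:M - circulant f) : 'M[K]_#|G|) =
  #|[pred x | fourier f x != z%:~R]|.
Proof.
set M := map_mx _ _.
have MV : M *m chr_mx =
    chr_mx *m diag_mx (\row_j (z%:~R - fourier f (elt j))).
  rewrite /M map_mxB mulmxBl circulant_chr_mx map_scalar_mx.
  have -> : (\row_j (z%:~R - fourier f (elt j))) =
    const_mx z%:~R - \row_j fourier f (elt j) by apply/rowP=> j; rewrite !mxE.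
  by rewrite raddfB /= mulmxBr diag_const_mx scalar_mxC.
have Vu := chr_mx_unit.
have Vr : row_free chr_mx by rewrite row_free_unit.
rewrite -(mxrankMfree M Vr) MV.
have Vf : row_full chr_mx by rewrite row_full_unit.
rewrite (eqmxMfull _ Vf) mxrank_diag.
rewrite -[RHS]sum1_card [RHS]big_mkcond [RHS]big_elt.
by apply: eq_bigr => i _; rewrite mxE subr_eq0 eq_sym inE; case: eqP.
Qed.

End Characters.
End FiniteFourier.

(** * Evaluation of the characteristic polynomial; primitive roots of unity *)

Lemma horner_char_poly (n : nat) (M : 'M[int]_n) (z : int) :
  (char_poly M).[z] = \det (z%:M - M).
Proof.
(* Evaluation at z is a ring morphism, hence commutes with the determinant. *)
rewrite -/(horner_eval z _) -det_map_mx; congr (\det _); apply/matrixP => i j.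
by rewrite !mxE rmorphB rmorphMn /= /horner_eval hornerX hornerC.
Qed.

(** In characteristic 0 the polynomial X^N - 1 is separable, so it has N distinct roots; among N
    distinct N-th roots of unity one is primitive. *)
Lemma has_prim_root_closed (C : numClosedFieldType) (N : nat) :
  (0 < N)%N -> exists w : C, N.-primitive_root w.
Proof.
move=> N0; have [r Dp] := closed_field_poly_normal ('X^N - 1 : {poly C}).
rewrite (monicP _) ?monicXnsubC // scale1r in Dp.
have rN : all N.-unity_root r by apply/allP => x; rewrite -root_prod_XsubC -Dp.
have sz_r : (N < (size r).+1)%N.
  by rewrite -(size_prod_XsubC r id) -Dp size_XnsubC.
have [|w _ w_prim] := hasP (has_prim_root N0 rN _ sz_r); last by exists w.
by rewrite -separable_prod_XsubC -Dp separable_Xn_sub_1 // pnatr_eq0 -lt0n.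
Qed.

Lemma finField_prim_root (F : finFieldType) :
  exists w : F, #|F|.-1.-primitive_root w.
Proof.
pose r := enum [pred x : F | x != 0].
have sz_r : size r = #|F|.-1 by rewrite -cardE (cardC1 (0 : F)).
have rN : all #|F|.-1.-unity_root r.
  apply/allP => x; rewrite mem_enum inE => x0; apply/unity_rootP.
  apply: (mulfI x0); rewrite mulr1 -exprS prednK ?expf_card //.
  exact: ltnW (finNzRing_gt1 F).
have F0 : (0 < #|F|.-1)%N.
  by rewrite -ltnS prednK ?finNzRing_gt1 // ltnW // finNzRing_gt1.
have rF : (#|F|.-1 <= size r)%N by rewrite sz_r.
have [w _ w_prim] := hasP (has_prim_root F0 rN (enum_uniq _) rF).
by exists w.
Qed.

(** * Homomorphisms on the lattice in coordinates *)

Section LatticeHoms.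
Variables (n : nat) (A : {fset 'rV[int]_n}) (r : nat) (e : 'I_r -> lattice A).
Hypothesis e_basis : zbasis e.

Definition coord (v : lattice A) : {ffun 'I_r -> int} :=
  projT1 (cid (e_basis v)).

Lemma coordK (v : lattice A) : v = \sum_i e i *~ coord v i.
Proof. by rewrite {1}(proj1 (projT2 (cid (e_basis v)))). Qed.

Lemma coord_unique (v : lattice A) (k : {ffun 'I_r -> int}) :
  v = \sum_i e i *~ k i -> coord v = k.
Proof. exact: (proj2 (projT2 (cid (e_basis v)))). Qed.

Lemma coordD : {morph coord : u v / u + v}.
Proof.
move=> u v; apply: coord_unique; rewrite {1}(coordK u) {1}(coordK v) -big_split.
by apply: eq_bigr => i _; rewrite ffunE mulrzDr.
Qed.

Lemma coord_basis (i j : 'I_r) : coord (e i) j = (i == j)%:R.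
Proof.
rewrite (@coord_unique _ [ffun j => (i == j)%:R]) ?ffunE //.
rewrite (bigD1 i) //= ffunE eqxx mulr1z big1 ?addr0 // => k.
by rewrite ffunE eq_sym => /negPf ->.
Qed.

Section Units.
Variables (R : comUnitRingType).
Implicit Types (x y : lattice A -> R).

Lemma Hom_units0 x : Hom_units A R x -> x 0 = 1.
Proof. by case=> xU xD; apply: (mulrI (xU 0)); rewrite mulr1 -xD addr0. Qed.

Lemma Hom_units_mulz x v (k : int) : Hom_units A R x -> x (v *~ k) = x v ^ k.
Proof.
move=> xH; have [xU xD] := xH.
have xMn u (m : nat) : x (u *+ m) = x u ^+ m.
  by elim: m => [|m IHm]; rewrite ?mulr0n ?Hom_units0 // mulrS exprS xD IHm.
case: k => m; first exact: xMn.
rewrite NegzE mulrNz -exprnN -pmulrn -xMn.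
by apply: (mulrI (xU (v *+ m.+1))); rewrite divrr // -xD subrr Hom_units0.
Qed.

Lemma Hom_units_coord x v :
  Hom_units A R x -> x v = \prod_i x (e i) ^ coord v i.
Proof.
move=> xH; rewrite {1}(coordK v) (big_morph x (proj2 xH) (Hom_units0 xH)).
by apply: eq_bigr => i _; apply: Hom_units_mulz.
Qed.

Lemma Hom_units_basis_inj x y : Hom_units A R x -> Hom_units A R y ->
  (forall i, x (e i) = y (e i)) -> x = y.
Proof.
move=> xH yH xy; apply/funext => v; rewrite !Hom_units_coord //.
by apply: eq_bigr => i _; rewrite xy.
Qed.

Lemma Hom_units_set_bij :
  set_bij (Hom_units A R) [set u : 'I_r -> R | forall i, u i \is a GRing.unit]
    (fun x i => x (e i)).
Proof.
split=> [x xH i|x y|u uU] /=; first exact: (proj1 xH).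
  rewrite !inE => xH yH xy; apply: Hom_units_basis_inj => // i.
  exact: (congr1 (@^~ i) xy).
(* The homomorphism with prescribed values [u i] on the basis. *)
exists (fun v => \prod_i u i ^ coord v i).
  split=> [v|v v'] /=.
    by apply: rpred_prod => i _; apply: rpredXz.
  rewrite -big_split coordD; apply: eq_bigr => i _ /=.
  by rewrite ffunE exprzDr.
apply/funext => i; rewrite (bigD1 i) //= coord_basis eqxx expr1z big1 ?mulr1 //.
by move=> j; rewrite coord_basis eq_sym => /negPf ->; rewrite expr0z.
Qed.

End Units.

(** * Homomorphisms into roots of unity as characters *)

Section RootsOfUnity.
Variables (N : nat).
Local Notation G := {ffun 'I_r -> 'I_N.+1}.

(* [inZp 1] and not [1], since ['I_1] is not a ring. *)
Definition red (v : lattice A) : G :=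
  [ffun i => (inZp 1 : 'I_N.+1) *~ coord v i].

Lemma redD : {morph red : u v / u + v}.
Proof. by move=> u v; apply/ffunP => i; rewrite !ffunE coordD ffunE mulrzDr. Qed.

Variables (K : fieldType) (w : K).
Hypothesis w_prim : N.+1.-primitive_root w.

Definition hom (x : G) (v : lattice A) : K := chr w x (red v).

Lemma hom_basis (x : G) i : hom x (e i) = w ^+ x i.
Proof.
have wN : w ^+ N.+1 = 1 := prim_expr_order w_prim.
rewrite /hom /chr (bigD1 i) //= big1 ?mulr1 => [|j].
  (* [inZp 1] has value 1 mod N+1, which is 0 when N = 0; the reduction is harmless in an exponent
     of an (N+1)-th root of unity. *)
  rewrite ffunE coord_basis eqxx mulr1z /= exprM expr_mod ?expr1 //.
  by rewrite -exprM mulnC exprM wN expr1n.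
by rewrite ffunE coord_basis eq_sym => /negPf ->; rewrite muln0.
Qed.

Lemma hom_Hom_mu (x : G) : Hom_mu A N.+1 K (hom x).
Proof.
split; first split=> [v|u v] /=; first by rewrite unitfE chr_neq0.
  by rewrite /hom redD chrD.
move=> v; apply/unity_rootP; rewrite -prodrXl big1 // => i _.
by rewrite -exprM mulnC exprM (prim_expr_order w_prim) expr1n.
Qed.

Lemma hom_inj : injective hom.
Proof.
move=> x y xy; apply/ffunP => i; apply/val_inj/eqP.
have := congr1 (@^~ (e i)) xy; rewrite !hom_basis => /eqP.
by rewrite (eq_prim_root_expr w_prim) !modn_small.
Qed.

(** The values on the basis are powers of w, and they determine the homomorphism. *)
Lemma Hom_mu_hom (y : lattice A -> K) : Hom_mu A N.+1 K y ->
  exists x, y = hom x.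
Proof.
move=> [yH yN].
have /fin_all_exists[x xE] i : exists j : 'I_N.+1, y (e i) = w ^+ j.
  by have [j ->] := prim_rootP w_prim (elimT unity_rootP (yN (e i))); exists j.
exists [ffun i => x i]; apply: Hom_units_basis_inj => // [|i].
  by have [] := hom_Hom_mu [ffun i => x i].
by rewrite hom_basis ffunE.
Qed.

(** The predicate [P] covers two uses: trivial for [B_poly], and W = z for the count. *)
Lemma fset_set_Hom_mu (P : set (lattice A -> K)) :
  perm_eq (fset_set [set x | Hom_mu A N.+1 K x /\ P x])
    [seq hom x | x <- enum G & `[< P (hom x) >]].
Proof.
set D := [set x | _].
(* Finiteness comes first, as [fset_set] of an infinite set would be empty. *)
have D_fin : finite_set D.
  apply: sub_finite_set (finite_image hom (@finite_finset _ setT)).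
  by move=> y [/Hom_mu_hom[x ->] _]; exists x.
apply: uniq_perm; first exact: fset_uniq.
  by rewrite (map_inj_uniq hom_inj) filter_uniq ?enum_uniq.
move=> y; rewrite in_fset_set //.
apply/idP/mapP => [|[x]].
  rewrite inE => -[/Hom_mu_hom[x ->] Px]; exists x => //.
  by rewrite mem_filter mem_enum andbT; apply/asboolP.
rewrite mem_filter => /andP[/asboolP Px _] ->; rewrite inE.
by split => //; apply: hom_Hom_mu.
Qed.

Variable c : A -> nat.

(** Depends on neither [K] nor [w]: a single integer circulant serves both over C and over the
    finite field. *)
Definition weight (g : G) : int :=
  \sum_(a : A) \sum_(b : A) (c a * c b)%:R *+ (red (diff a b) == g).

Lemma W_hom (x : G) : W c K (hom x) = fourier w weight x.
Proof.
rewrite /fourier /weight.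
under eq_bigr => g _.
  rewrite raddf_sum mulr_suml; under eq_bigr => a _.
    rewrite raddf_sum mulr_suml; over.
  over.
rewrite exchange_big; apply: eq_bigr => a _ /=.
rewrite exchange_big; apply: eq_bigr => b _ /=.
(* For fixed a and b only the term g = [red (diff a b)] survives. *)
rewrite (bigD1 (red (diff a b))) //= eqxx mulr1n rmorph_nat big1 ?addr0 // => g.
by rewrite eq_sym => /negPf ->; rewrite mulr0n mul0r.
Qed.

Lemma B_poly_fourier :
  B_poly c N.+1 K = \prod_(x : G) ('X - (fourier w weight x)%:P).
Proof.
have := fset_set_Hom_mu setT.
have -> : [set x | Hom_mu A N.+1 K x /\ [set: lattice A -> K] x] =
    Hom_mu A N.+1 K.
  by apply/seteqP; split=> x //= -[].
rewrite /B_poly => homE; rewrite (perm_big _ homE) big_map big_filter.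
rewrite big_enum_cond /=.
by apply: eq_big => [x|x _]; rewrite ?W_hom //; apply/asboolP.
Qed.

(** The count takes the form of a corank, to match [mxrank_circulant] and [prime_exp_dvd_det]. *)
Lemma card_Hom_mu_W (z : int) :
  #|` fset_set [set x | Hom_mu A N.+1 K x /\ W c K x = z%:~R]| =
  (#|G| - #|[pred x | fourier w weight x != z%:~R]|)%N.
Proof.
rewrite (perm_size (fset_set_Hom_mu [set x | W c K x = z%:~R])) size_map.
rewrite -(cardC [pred x | fourier w weight x != z%:~R]) addKn.
rewrite cardE [in RHS]/enum_mem enumT; congr size; apply: eq_filter => x.
by rewrite !inE negbK -W_hom; apply/asboolP/eqP.
Qed.

End RootsOfUnity.
End LatticeHoms.

(** * Application to C and to the finite field *)

(** Every nonzero element of [F] is a (|F| - 1)-th root of unity, so the description by characters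
    covers all unit-valued homomorphisms. *)
Lemma Hom_mu_finField (n : nat) (A : {fset 'rV[int]_n}) (F : finFieldType) :
  Hom_mu A #|F|.-1 F = Hom_units A F.
Proof.
apply/seteqP; split=> [x []//|x xH]; split => // v; apply/unity_rootP.
have xv0 : x v != 0 by rewrite -unitfE; apply: (proj1 xH).
apply: (mulfI xv0); rewrite mulr1 -exprS prednK ?expf_card //.
exact: ltnW (finNzRing_gt1 F).
Qed.

Theorem proposition3
    (R : realType) (n : nat) (A : {fset 'rV[int]_n}) (c : A -> nat)
    (p nu : nat) (F : finFieldType) (z : int) :
  (0 < n)%N ->
  (forall a : A, (0 < c a)%N) ->
  lattice_rank A n ->
  prime p -> (0 < nu)%N -> #|F| = (p ^ nu)%N ->
  (exists B : {poly int},
      map_poly intr B = B_poly c (p ^ nu - 1) (complex R) /\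
      (((#|` fset_set [set xi | Hom_units A F xi /\ W c F xi = z%:~R] |)%:Z)%:E
         <= vp p B.[z])%E) /\
  (forall e : 'I_n -> lattice A, zbasis e ->
     set_bij (Hom_units A F) [set u : 'I_n -> F | forall i, u i \is a GRing.unit]
             (fun xi i => xi (e i))).
Proof.
move=> _ _ [e e_basis] p_pr nu0 cardF; split; last first.
  by move=> e' e'_basis; apply: Hom_units_set_bij.
have charF : p \in [pchar F] := card_finPcharP cardF p_pr.
have N0 : (0 < p ^ nu - 1)%N.
  by rewrite subn_gt0 -{1}(expn0 p) ltn_exp2l ?prime_gt1.
have NE : (p ^ nu - 1 = (p ^ nu - 1).-1.+1)%N by rewrite prednK.
have FE : #|F|.-1 = (p ^ nu - 1)%N by rewrite cardF subn1.
have [w w_prim] := has_prim_root_closed (complex R) N0.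
have [t t_prim] := finField_prim_root F.
rewrite -Hom_mu_finField; rewrite {}FE in t_prim *.
(* From here on [N.+1] stands for p^nu - 1, the form used for the modulus of G. *)
set N := (p ^ nu - 1)%N.-1 in NE *; rewrite {}NE in w_prim t_prim *.
exists (char_poly (circulant (@weight _ _ _ _ e_basis N c))); split.
  by rewrite (char_poly_circulant w_prim) (B_poly_fourier e_basis w_prim).
rewrite (card_Hom_mu_W e_basis t_prim) horner_char_poly /vp.
(* If B(z) = 0 the valuation is infinite; otherwise the bound amounts to divisibility of the
   determinant by a power of p. *)
case: eqP => [_|/eqP det0]; first exact: leey.
rewrite lee_fin lez_nat -pfactor_dvdn ?absz_gt0 //.
rewrite -(mxrank_circulant t_prim).
exact: prime_exp_dvd_det.
Qed.
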